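(* Let $X$ be a space and let $\mathfrak{P}$ be a closed hereditary topological property preserved under finite closed sums. Then \[C^\mathfrak{P}_0(X)=\big\{f\in C_b(X):|f|^{-1}\big([1/n,\infty)\big)\text{ has }\mathfrak{P}\text{ for each positive integer }n\big\},\] and in particular, \[C^\mathfrak{P}_0(X)=\big\{f\in C_b(X):\mathrm{coz}(f)\text{ has }\mathfrak{P}\big\}\] if $\mathfrak{P}$ is preserved under countable closed sums. Furthermore: (1) $C^\mathfrak{P}_0(X)$ is a closed ideal in $C_b(X)$. (2) $C^\mathfrak{P}_{00}(X)\subseteq C^\mathfrak{P}_0(X)$. (3) Let $X$ be completely regular. Then $C^\mathfrak{P}_0(X)$ is of empty hull if and only if $X$ is locally-$\mathfrak{P}$. (4) Let $X$ be completely regular and locally-$\mathfrak{P}$. Then $C^\mathfrak{P}_0(X)$ is unital if and only if $X$ has $\mathfrak{P}$. (5) Let $X$ be completely regular and locally-$\mathfrak{P}$. Furthermore, suppose that either $X$ is normal, or $\mathfrak{P}$ is preserved under countable closed sums. Then $C^\mathfrak{P}_0(X)$ is a Banach algebra isometrically isomorphic to $C_0(Y)$ for some unique (up to homeomorphism) locally compact Hausdorff space $Y$, namely $Y=\lambda_\mathfrak{P}X$. Furthermore, $X$ is dense in $Y$ (in particular $X\subseteq Y$); $C^\mathfrak{P}_{00}(X)$ is dense in $C^\mathfrak{P}_0(X)$; and $C^\mathfrak{P}_0(X)$ is unital if and only if $X$ has $\mathfrak{P}$ if and only if $Y$ is compact.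
   Context: A space is a topological space; completely regular spaces and normal spaces are taken to be Hausdorff, and $\beta X$ is the Stone–Čech compactification of $X$, containing $X$ as a dense subspace. $C_b(X)$ is the normed algebra of continuous bounded $f:X\to\mathbb{R}$ with pointwise operations and the supremum norm; $\mathrm{coz}(f)=X\setminus f^{-1}(0)$, $\mathrm{supp}(f)=\mathrm{cl}_X\mathrm{coz}(f)$, and $\mathrm{Coz}(X)$ is the set of all cozero-sets of continuous real-valued functions on $X$. $C_0(Y)$ is the set of continuous bounded $f:Y\to\mathbb{R}$ with $|f|^{-1}([1/n,\infty))$ compact for each positive integer $n$. A neighborhood of a set $A$ in $X$ is a set $U\subseteq X$ with $A\subseteq\mathrm{int}_XU$. A topological property $\mathfrak{P}$ is closed hereditary if every closed subspace of a space with $\mathfrak{P}$ has $\mathfrak{P}$; it is preserved under finite (resp. countable) closed sums if every space which is a finite (resp. countable) union of closed subspaces each having $\mathfrak{P}$ has $\mathfrak{P}$. A space is locally-$\mathfrak{P}$ if each of its points has a neighborhood (in the space) with $\mathfrak{P}$. $\mathscr{I}_\mathfrak{P}=\{A\subseteq X:\mathrm{cl}_XA\text{ has }\mathfrak{P}\}$; its elements are called null. $C^\mathfrak{P}_{00}(X)=\{f\in C_b(X):\mathrm{supp}(f)\text{ has a null neighborhood in }X\}$ and $C^\mathfrak{P}_0(X)=\{f\in C_b(X):|f|^{-1}([1/n,\infty))\text{ has a null neighborhood in }X\text{ for each positive integer }n\}$. $\lambda_\mathfrak{P}X=\bigcup\{\mathrm{int}_{\beta X}\mathrm{cl}_{\beta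 X}C:C\in\mathrm{Coz}(X)\text{ and }\mathrm{cl}_XC\text{ has a null neighborhood in }X\}$, considered as a subspace of $\beta X$. An ideal $H$ of $C_b(X)$ is of empty hull if for every $x\in X$ there is $h\in H$ with $h(x)\neq0$. An algebra is unital if it has a multiplicative unit element. ''Isometrically isomorphic'' means by an isometric algebra isomorphism. *)

(* Defs.v *)
From HB Require Import structures.
From mathcomp Require Import all_boot all_order all_algebra.
From mathcomp Require Import all_classical all_reals all_analysis.
Import numFieldNormedType.Exports.
Import Order.TTheory GRing.Theory Num.Theory.

Set Implicit Arguments.
Unset Strict Implicit.
Unset Printing Implicit Defensive.

Local Open Scope classical_set_scope.
Local Open Scope ring_scope.

Section Cb_closed.
Context (X : topologicalType) (R : realType).

Definition Cb_pred : {pred X -> R} :=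
  fun f => `[< continuous f /\ bounded_fun f >].

Lemma Cb_predP (f : X -> R) :
  reflect (continuous f /\ exists M, forall x, `|f x| <= M) (f \in Cb_pred).
Proof.
apply: (iffP (asboolP _)) => -[cf bf]; split => //.
  by have [M [_ /(_ (M + 1))]] := bf; rewrite ltrDl ltr01 => /(_ isT) fM;
    exists (M + 1) => x; exact: fM.
have [M fM] := bf; exists M; split; first exact: num_real.
by move=> N MN x _ /=; apply: le_trans (fM x) (ltW MN).
Qed.

Lemma Cb_submod_closed : submod_closed Cb_pred.
Proof.
split => [|a f g /Cb_predP[cf [M fM]] /Cb_predP[cg [N gN]]].
  apply/Cb_predP; split; first by move=> x; exact: cvg_cst.
  by exists 0 => x; rewrite normr0.
apply/Cb_predP; split.
  by move=> x; apply: cvgD; [apply: cvgZl_tmp; exact: cf|exact: cg].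
exists (`|a| * M + N) => x; apply: le_trans (ler_normD _ _) _.
by rewrite lerD// normrM ler_wpM2l.
Qed.

Lemma Cb_subring_closed : subring_closed Cb_pred.
Proof.
have [C0 CD] := Cb_submod_closed.
split => [|f g fC gC|f g /Cb_predP[cf [M fM]] /Cb_predP[cg [N gN]]].
- apply/Cb_predP; split; first by move=> x; exact: cvg_cst.
  by exists 1 => x; rewrite normr1.
- by have := CD (-1) g f gC fC; rewrite scaleN1r addrC.
- apply/Cb_predP; split; first by move=> x; apply: cvgM; [exact: cf|exact: cg].
  exists (M * N) => x; rewrite normrM; exact: ler_pM.
Qed.

HB.instance Definition _ := GRing.isSubmodClosed.Build R (X -> R) Cb_pred
  Cb_submod_closed.
HB.instance Definition _ := GRing.isSubringClosed.Build (X -> R) Cb_pred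
  Cb_subring_closed.

End Cb_closed.

Record Cb (X : topologicalType) (R : realType) := MkCb {
  Cb_fun :> X -> R;
  Cb_funP : Cb_fun \in @Cb_pred X R
}.

HB.instance Definition _ X R := [isSub for @Cb_fun X R].
HB.instance Definition _ X R := [Choice of Cb X R by <:].
HB.instance Definition _ X R := [SubChoice_isSubZmodule of Cb X R by <:].
HB.instance Definition _ X R := [SubZmodule_isSubLmodule of Cb X R by <:].
HB.instance Definition _ X R :=
  GRing.SubZmodule_isSubPzRing.Build _ _ (Cb X R) (subringClosedP _).
HB.instance Definition _ X R :=
  GRing.SubPzRing_isSubComPzRing.Build _ _ (Cb X R).

Section Cb_norm.
Context (X : topologicalType) (R : realType).
Implicit Types f g : Cb X R.

(* When X is empty, Cb X R is the zero algebra and sup set0 = 0. *)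
Definition supnorm f : R := sup [set `|f x| | x in [set: X]].

Lemma supnorm_has_ubound f : has_ubound [set `|f x| | x in [set: X]].
Proof.
by have /Cb_predP[_ [M fM]] := Cb_funP f; exists M => _ [x _ <-]; exact: fM.
Qed.

Lemma ler_supnorm f x : `|f x| <= supnorm f.
Proof. by apply: ub_le_sup; [exact: supnorm_has_ubound|exists x]. Qed.

Lemma supnorm_ge0 f : 0 <= supnorm f.
Proof.
rewrite /supnorm.
have [->|/set0P[_ [x _ _]]] := eqVneq [set `|f x| | x in [set: X]] set0.
  by rewrite sup0.
exact: le_trans (normr_ge0 _) (ler_supnorm f x).
Qed.

Lemma supnorm_le f M : 0 <= M -> (forall x, `|f x| <= M) -> supnorm f <= M.
Proof.
move=> M0 fM; rewrite /supnorm.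
have [->|/set0P ne] := eqVneq [set `|f x| | x in [set: X]] set0.
  by rewrite sup0.
by apply: ge_sup => // _ [x _ <-].
Qed.

Lemma supnormD f g : supnorm (f + g) <= supnorm f + supnorm g.
Proof.
apply: supnorm_le => [|x]; first by rewrite addr_ge0// supnorm_ge0.
by apply: le_trans (ler_normD _ _) _; rewrite lerD// ler_supnorm.
Qed.

Lemma supnormZ (a : R) f : supnorm (a *: f) = `|a| * supnorm f.
Proof.
have le (b : R) g : supnorm (b *: g) <= `|b| * supnorm g.
  apply: supnorm_le => [|x]; first by rewrite mulr_ge0// supnorm_ge0.
  have -> : (b *: g) x = b * g x by [].
  by rewrite normrM ler_wpM2l// ler_supnorm.
apply/eqP; rewrite eq_le le /=.
have [->|a0] := eqVneq a 0; first by rewrite normr0 mul0r supnorm_ge0.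
rewrite -ler_pdivlMl ?normr_gt0// -normfV.
by apply: le_trans (le a^-1 (a *: f)); rewrite scalerA mulVf// scale1r.
Qed.

Lemma supnorm0_eq0 f : supnorm f = 0 -> f = 0.
Proof.
move=> f0; apply/val_inj/funext => x /=; apply/eqP.
by rewrite -normr_le0 -f0 ler_supnorm.
Qed.

HB.instance Definition _ := Lmodule_isNormed.Build R (Cb X R)
  supnormD supnormZ supnorm0_eq0.

End Cb_norm.

Section ideals_and_subalgebras.
Context (X : topologicalType) (R : realType).
Implicit Types (e f g : Cb X R) (A H : set (Cb X R)).

Definition is_ideal H :=
  [/\ H 0, (forall f g, H f -> H g -> H (f + g))
    & (forall f g, H g -> H (f * g))].

Definition empty_hull H := forall x, exists2 h : Cb X R, H h & h x != 0.

Definition is_subalgebra A :=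
  [/\ A 0, (forall f g, A f -> A g -> A (f + g)),
      (forall (a : R) f, A f -> A (a *: f))
    & (forall f g, A f -> A g -> A (f * g))].

Definition is_unital A :=
  exists2 e, A e & forall f, A f -> e * f = f /\ f * e = f.

Definition is_complete A := forall F : set_system (Cb X R),
  ProperFilter F -> F A -> cauchy F -> exists2 f, A f & F --> f.

Definition is_banach_algebra A :=
  [/\ is_subalgebra A,
      (forall f g, A f -> A g -> `|f * g| <= `|f| * `|g|)
    & is_complete A].

End ideals_and_subalgebras.

Definition isometrically_isomorphic (X Y : topologicalType) (R : realType)
    (A : set (Cb X R)) (B : set (Cb Y R)) :=
  exists phi : Cb X R -> Cb Y R,
    [/\ set_bij A B phi,
        (forall f g, A f -> A g -> phi (f + g) = phi f + phi g),
        (forall (a : R) f, A f -> phi (a *: f) = a *: phi f),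
        (forall f g, A f -> A g -> phi (f * g) = phi f * phi g)
      & (forall f, A f -> `|phi f| = `|f|)].

Definition coz (X : topologicalType) (R : realType) (f : X -> R) : set X :=
  ~` (f @^-1` [set 0]).

Definition supp (X : topologicalType) (R : realType) (f : X -> R) : set X :=
  closure (coz f).

Definition is_cozero (R : realType) (X : topologicalType) (C : set X) :=
  exists2 f : X -> R, continuous f & C = coz f.

Definition abs_ge (X : topologicalType) (R : realType) (f : X -> R) (n : nat)
  : set X := [set x | n%:R^-1 <= `|f x|].

Definition C0 (Y : topologicalType) (R : realType) : set (Cb Y R) :=
  [set f | forall n, (0 < n)%N -> compact (abs_ge f n)].

Definition homeomorphic (T U : topologicalType) :=
  exists (f : T -> U) (g : U -> T),
    [/\ continuous f, continuous g, cancel f g & cancel g f].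

Section topological_properties.
Variable P : topologicalType -> Prop.

Definition topological_property :=
  forall T U : topologicalType, homeomorphic T U -> P T -> P U.

Definition subset_has (T : topologicalType) (A : set T) := P (set_type A).

Definition closed_hereditary := forall (T : topologicalType) (A : set T),
  P T -> closed A -> subset_has A.

(* The empty family is allowed: the empty space has every property that is
   preserved under finite closed sums. *)
Definition preserved_finite_closed_sums :=
  forall (T : topologicalType) (F : set (set T)),
  finite_set F -> (forall A, F A -> closed A /\ subset_has A) ->
  \bigcup_(A in F) A = setT -> P T.

Definition preserved_countable_closed_sums :=
  forall (T : topologicalType) (F : set (set T)),
  countable F -> (forall A, F A -> closed A /\ subset_has A) ->
  \bigcup_(A in F) A = setT -> P T.

Definition locally_has (T : topologicalType) :=
  forall x : T, exists2 U : set T, nbhs x U & subset_has U.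

Definition is_null (T : topologicalType) (A : set T) := subset_has (closure A).

Definition has_null_nbhd (T : topologicalType) (A : set T) :=
  exists2 U : set T, A `<=` U° & is_null U.

Definition C00P (X : topologicalType) (R : realType) : set (Cb X R) :=
  [set f | has_null_nbhd (supp f)].

Definition C0P (X : topologicalType) (R : realType) : set (Cb X R) :=
  [set f | forall n, (0 < n)%N -> has_null_nbhd (abs_ge f n)].

End topological_properties.

Arguments C0 : clear implicits.
Arguments C00P : clear implicits.
Arguments C0P : clear implicits.

Definition completely_regular_hausdorff (T : topologicalType) :=
  completely_regular_space T /\ hausdorff_space T.

Definition normal_hausdorff (T : topologicalType) :=
  normal_space T /\ hausdorff_space T.

Section stone_cech.
Context (X : topologicalType) (R : realType).

(* The closure of the image of X in the product of copies of R indexed by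
   Cb X R, under x |-> (f x)_f; the lemmas below show that this is the
   Stone-Cech compactification when X is completely regular and Hausdorff. *)
Definition stone_cech_eval :
    X -> prod_topology (fun _ : Cb X R => R : topologicalType) :=
  join_product (fun f : Cb X R => f : X -> R).

Definition stone_cech : topologicalType :=
  set_type (closure (range stone_cech_eval)).

Definition to_stone_cech (x : X) : stone_cech :=
  exist _ (stone_cech_eval x)
    (mem_set (subset_closure (imageT stone_cech_eval x))).

End stone_cech.

Arguments stone_cech : clear implicits.
Arguments to_stone_cech : clear implicits.

Section stone_cech_facts.
Context (X : topologicalType) (R : realType).

Lemma stone_cech_compact : compact [set: stone_cech X R].
Proof.
pose A := closure (range (@stone_cech_eval X R)).
have cA : compact A.
  pose B := [set h : prod_topology (fun _ : Cb X R => R : topologicalType) |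
    forall f : Cb X R, `[- supnorm f, supnorm f]%classic (h f)].
  have cB : compact B.
    by apply: (@tychonoff _ _ (fun f : Cb X R => `[- supnorm f, supnorm f]%classic)) => i; exact: segment_compact.
  apply: (subclosed_compact _ cB); first exact: closed_closure.
  rewrite -[X in _ `<=` X](_ : closure B = B).
    apply: closureS => _ [x _ <-] h /=.
    by rewrite in_itv /= -ler_norml ler_supnorm.
  apply/esym/closure_id; apply: compact_closed cB.
  by apply: hausdorff_product => i; exact: Rhausdorff.
move=> F FF FT.
pose G := (@set_val _ A) @ F.
have [|p [Ap Gp]] := cA G _.
  by rewrite /G /=; apply: filterS FT => y _; exact: set_valP.
exists (exist _ p (mem_set Ap)); split; first by [].
move=> U V FU.
rewrite nbhsE => -[_ [[W oW <-] Wp] WV].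
have [q [[y Uy yq] Wq]] : (set_val @` U) `&` W !=set0.
  apply: Gp; last exact: open_nbhs_nbhs.
  by rewrite /G /=; apply: filterS FU => y Uy; exists y.
by exists y; split => //; apply: WV => /=; rewrite yq.
Qed.

Lemma stone_cech_hausdorff : hausdorff_space (stone_cech X R).
Proof.
move=> p q pq; apply: val_inj.
have H : hausdorff_space (prod_topology (fun _ : Cb X R => R : topologicalType)).
  by apply: hausdorff_product => i; exact: Rhausdorff.
apply: H => U V pU qV.
have [y [Uy Vy]] : ([set z : stone_cech X R | U (set_val z)] `&`
    [set z | V (set_val z)]) !=set0.
  apply: pq; [exact: (@initial_continuous (stone_cech X R) _ set_val p)|exact: (@initial_continuous (stone_cech X R) _ set_val q)].
by exists (set_val y).
Qed.

Lemma to_stone_cech_dense : dense (range (to_stone_cech X R)).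
Proof.
move=> O [[p Ap] Op] oO; case: oO Op => W oW <- /= Wp.
have [_ [[x _ <-] Wq]] := set_mem Ap W (open_nbhs_nbhs (conj oW Wp)).
by exists (to_stone_cech X R x); split => //; exists x.
Qed.

Lemma to_stone_cech_embedding : completely_regular_hausdorff X ->
  injective (to_stone_cech X R) /\
  (forall U : set X, open U <->
     exists2 V, open V & U = to_stone_cech X R @^-1` V).
Proof.
move=> [crX hX].
have sep : separate_points_from_closed (fun f : Cb X R => f : X -> R).
  move=> U x cU Ux; have /(@uniform_separatorP _ R)[h [ch h01 hx hU]] := crX x U cU Ux.
  have hC : h \in @Cb_pred X R.
    apply/Cb_predP; split => //; exists 1 => y.
    have /h01 : range h (h y) by exists y.
    by rewrite /= in_itv /= => /andP[h0 h1]; rewrite ger0_norm.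
  exists (MkCb hC) => /= /(closureS hU).
  have -> : h x = 0 by apply: hx; exists x.
  have /closure_id <- : closed [set (1 : R)] by exact: closed_eq.
  by move/eqP; rewrite eq_sym oner_eq0.
have cts (k : Cb X R) : continuous k by have /Cb_predP[] := Cb_funP k.
have inj := join_product_inj sep (hausdorff_accessible hX).
split; first by move=> x y /(congr1 val) /= /inj; apply; rewrite inE.
move=> U; rewrite (join_product_initial sep cts inj); split.
  by move=> [V oV <-]; exists (set_val @^-1` V) => //; exists V.
by move=> [_ [V oV <-] ->]; exists V.
Qed.

Lemma stone_cech_extend (f : Cb X R) : exists2 F : stone_cech X R -> R,
  continuous F & forall x, F (to_stone_cech X R x) = f x.
Proof.
exists (fun p => set_val p f); last by [].
move=> p; have c1 := @initial_continuous (stone_cech X R) _ set_val p.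
have c2 := @proj_continuous _ (fun _ : Cb X R => R : topologicalType) f (set_val p).
exact: cvg_comp c1 c2.
Qed.

End stone_cech_facts.

Definition lambda_set (P : topologicalType -> Prop) (X : topologicalType)
    (R : realType) : set (stone_cech X R) :=
  \bigcup_(C in [set C : set X | is_cozero R C /\ has_null_nbhd P (closure C)])
    (closure (to_stone_cech X R @` C))°.

Arguments lambda_set : clear implicits.

Definition lambda_space (P : topologicalType -> Prop) (X : topologicalType)
    (R : realType) : topologicalType :=
  set_type (lambda_set P X R).

(* Main.v *)
Require Import Defs.
From mathcomp Require Import all_boot all_order all_algebra.
From mathcomp Require Import all_classical all_reals all_analysis.
From mathcomp Require Import ring lra.
Import numFieldNormedType.Exports.
Import Order.TTheory GRing.Theory Num.Theory.
Set Implicit Arguments.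
Unset Strict Implicit.
Unset Printing Implicit Defensive.
Local Open Scope classical_set_scope.
Local Open Scope ring_scope.

(** Write [iota : X -> beta] for the map of [X] into its Stone-Cech
    compactification, and [lambda] for the open subset of [beta] that defines [Y].

    The level sets [|f| >= 1/n] of one function are nested so that each is a closed
    neighbourhood of the previous one.  Hence the null neighbourhoods in the
    definition of [C0P] can be taken among the level sets themselves
    ([C0P_abs_ge]), and the ideal, closure and unit statements become inclusions
    between level sets of different functions.  When [X] is completely regular and
    locally has the property, [C0P] contains a function with value one at any given
    point ([C0P_peak]), so its hull is empty and its only possible unit is the
    constant [1].

    The isomorphism with [C0 Y] is extension to [beta] followed by restriction to
    [Y] ([lambda_ext_isometric]).  It is injective, isometric and compatible with the
    operations because [X] is dense in [Y].  That it relates exactly the members of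
    [C0P] and of [C0 Y] is the heart of the matter ([lambda_ext_C0]).  If [f] is in
    [C0P] and its extension is nonzero at [p], then [p] is interior to the closure
    of a cozero-set [|f| > 1/n], which has a null neighbourhood, so [p] is in
    [lambda]; the level sets of the extension are thus closed subsets of the compact
    space [beta] that lie inside [lambda].  Conversely, a compact level set in [Y]
    is covered by finitely many of the sets making up [lambda], and their traces on
    [X] lie in finitely many closed sets having the property.

    The space [Y] is determined by [C0 Y] because every character of the algebra
    [C0 Z], for any space [Z], is a point evaluation ([character_eval]).  An
    isomorphism of [C0 Y] onto [C0 Z] therefore is composition with a map
    from [Z] to [Y], its inverse is composition with a map back, and for locally
    compact Hausdorff spaces the functions in [C0] separate points and have
    cozero-sets forming a base, so that the two maps are inverse homeomorphisms
    ([C0_isomorphic_homeomorphic]).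

    Density of [C00P] comes from shrinking the values of [f] towards zero by [1/n],
    which moves the support into a level set of [f] ([C00P_dense]). *)

(** * Topological properties of subspaces *)

Lemma continuous_to_subtype (S T : topologicalType) (A : set T)
    (f : S -> set_type A) :
  continuous (set_val \o f) -> continuous f.
Proof.
move=> cf; apply/continuousP => _ [V oV <-].
by move/continuousP : cf => /(_ V oV).
Qed.

Lemma continuous_set_val (T : topologicalType) (A : set T) :
  continuous (set_val : set_type A -> T).
Proof. exact: initial_continuous. Qed.

Lemma closed_set_val_preimage (T : topologicalType) (A C : set T) :
  closed C -> closed ((set_val : set_type A -> T) @^-1` C).
Proof.
by move=> cC; move/continuous_closedP: (@continuous_set_val T A); apply.
Qed.

Lemma homeomorphic_sym (T U : topologicalType) :
  homeomorphic T U -> homeomorphic U T.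
Proof. by case=> [f [g [cf cg fK gK]]]; exists g, f; split. Qed.

(** Lets the closure hypotheses on [P], which speak of subspaces of a space, be used
    for subsets of a subset of one fixed space. *)
Lemma homeomorphic_nested (T : topologicalType) (A B : set T) : B `<=` A ->
  homeomorphic (set_type ((set_val : set_type A -> T) @^-1` B)) (set_type B).
Proof.
move=> BA.
pose f (x : set_type ((set_val : set_type A -> T) @^-1` B)) : set_type B :=
  exist _ (set_val (set_val x)) (mem_set (set_valP x)).
pose a (y : set_type B) : set_type A :=
  exist _ (set_val y) (mem_set (BA _ (set_valP y))).
have aB y : ((set_val : set_type A -> T) @^-1` B) (a y) by exact: set_valP y.
pose g (y : set_type B) : set_type ((set_val : set_type A -> T) @^-1` B) :=
  exist _ (a y) (mem_set (aB y)).
exists f, g; split.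
- apply: continuous_to_subtype => x.
  apply: (@continuous_comp _ _ _ set_val set_val); exact: continuous_set_val.
- apply: continuous_to_subtype; apply: continuous_to_subtype.
  exact: (@continuous_set_val T B).
- by move=> x; do 2! apply: val_inj.
- by move=> y; apply: val_inj.
Qed.

Lemma homeomorphic_setT (T : topologicalType) :
  homeomorphic (set_type [set: T]) T.
Proof.
exists set_val, (fun x => exist _ x (mem_set I)); split => //.
- exact: continuous_set_val.
- by apply: continuous_to_subtype => x; exact: cvg_id.
- by move=> x; apply: val_inj.
Qed.

Section property.
Variable P : topologicalType -> Prop.
Hypothesis P_top : topological_property P.

Lemma subset_has_setT (T : topologicalType) : subset_has P [set: T] <-> P T.
Proof.
have h := homeomorphic_setT T.
by split => [/(P_top h)|/(P_top (homeomorphic_sym h))].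
Qed.

Hypothesis P_closed : closed_hereditary P.

Lemma subset_has_closedI (T : topologicalType) (A C : set T) :
  subset_has P A -> closed C -> subset_has P (A `&` C).
Proof.
move=> PA cC.
apply: P_top (homeomorphic_nested (@subIsetl _ A C)) _.
rewrite (_ : _ @^-1` _ = (set_val : set_type A -> T) @^-1` C).
  by apply: P_closed => //; exact: closed_set_val_preimage.
by apply/seteqP; split => [x []//|x Cx]; split => //; exact: set_valP.
Qed.

Lemma subset_has_closed_sub (T : topologicalType) (A C : set T) :
  subset_has P A -> closed C -> C `<=` A -> subset_has P C.
Proof.
by move=> PA cC CA; rewrite -(setIidr CA); exact: subset_has_closedI.
Qed.

(** Turns a cover of a subset of [T] by subsets of [T] into a cover of the subspace,
    which is the form in which preservation under closed sums is stated. *)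
Lemma closed_cover_traces (T : topologicalType) (A : set T) (G : set (set T)) :
  (forall B, G B -> [/\ closed B, B `<=` A & subset_has P B]) ->
  A `<=` \bigcup_(B in G) B ->
  let G' := [set (set_val : set_type A -> T) @^-1` B | B in G] in
  (forall B, G' B -> closed B /\ subset_has P B) /\
  \bigcup_(B in G') B = setT.
Proof.
move=> GP AG; split=> [_ [B /GP[cB BA PB] <-]|].
  split; first exact: closed_set_val_preimage.
  exact: P_top (homeomorphic_sym (homeomorphic_nested BA)) PB.
apply/seteqP; split => // x _; have [B GB Bx] := AG _ (set_valP x).
by exists ((set_val : set_type A -> T) @^-1` B) => //; exists B.
Qed.

Lemma subset_has_bigcup_countable (T : topologicalType) (A : set T)
    (F : nat -> set T) : preserved_countable_closed_sums P ->
  (forall n, [/\ closed (F n), F n `<=` A & subset_has P (F n)]) ->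
  A `<=` \bigcup_n F n -> subset_has P A.
Proof.
move=> sumP FP AF.
have [||GP GT] := @closed_cover_traces T A (range F).
- by move=> _ [n _ <-].
- by move=> x /AF[n _ Fnx]; exists (F n) => //; exists n.
apply: sumP GP GT; apply: card_le_trans (card_image_le _ _) _.
exact: card_image_le.
Qed.

Hypothesis P_sums : preserved_finite_closed_sums P.

Lemma subset_has_setU (T : topologicalType) (A B : set T) :
  closed A -> closed B -> subset_has P A -> subset_has P B ->
  subset_has P (A `|` B).
Proof.
move=> cA cB PA PB.
have [||GP GT] := @closed_cover_traces T (A `|` B) [set A; B].
- by move=> _ [|] ->; split => // x ?; by [left|right].
- by move=> x [Ax|Bx]; [exists A => //; left|exists B => //; right].
by apply: P_sums GP GT; apply: finite_image; exact: finite_set2.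
Qed.

Lemma subset_has_set0 (T : topologicalType) : subset_has P (@set0 T).
Proof.
apply: (P_sums (finite_set0 (set (set_type (@set0 T))))) => //.
by apply/seteqP; split => // x _; case: (set_valP x).
Qed.

End property.

(** * Level sets and the ideal C0P *)

Section Cb_basics.
Context (X : topologicalType) (R : realType).
Implicit Types f g : Cb X R.

Lemma Cb_continuous f : continuous f.
Proof. by have /Cb_predP[] := Cb_funP f. Qed.

Lemma Cb_intro (u : X -> R) (M : R) : continuous u -> (forall x, `|u x| <= M) ->
  u \in @Cb_pred X R.
Proof. by move=> cu uM; apply/Cb_predP; split => //; exists M. Qed.

Lemma abs_ge_closed (u : X -> R) n : continuous u -> closed (abs_ge u n).
Proof.
move=> cu; apply: (@closed_comp _ _ (fun x => `|u x|) [set y | n%:R^-1 <= y]).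
  by move=> x _; apply: cvg_norm; exact: cu.
exact: closed_ge.
Qed.

Lemma Cb_abs_ge_closed f n : closed (abs_ge f n).
Proof. by apply: abs_ge_closed; exact: Cb_continuous. Qed.

Lemma abs_gt_open (u : X -> R) (a : R) : continuous u ->
  open [set x | a < `|u x|].
Proof.
move=> cu; apply: (@open_comp _ _ (fun x => `|u x|) [set y | a < y]).
  by move=> x _; apply: cvg_norm; exact: cu.
exact: open_gt.
Qed.

(** The open set [|u| > 1/(n+1)] lies between two consecutive level sets. *)
Lemma abs_ge_interior (u : X -> R) n : continuous u -> (0 < n)%N ->
  abs_ge u n `<=` (abs_ge u n.+1)°.
Proof.
move=> cu n0 x ux.
rewrite /interior nbhsE; exists [set y | n.+1%:R^-1 < `|u y|].
  split; first exact: abs_gt_open.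
  by apply: lt_le_trans ux; rewrite ltf_pV2 ?posrE ?ltr0n// ltr_nat.
by move=> y /= /ltW.
Qed.

Lemma coz_abs_ge (u : X -> R) : coz u = \bigcup_(n in [set n | (0 < n)%N]) abs_ge u n.
Proof.
apply/seteqP; split => [x ux|x [n /= n0 ux] ux0]; last first.
  move: ux; rewrite /abs_ge /= ux0 normr0 leNgt => /negP; apply.
  by rewrite invr_gt0 ltr0n.
have un0 : 0 < `|u x| by rewrite normr_gt0; apply/eqP.
pose n := (Num.truncn `|u x|^-1).+1.
exists n => //=; rewrite /abs_ge /= -[leRHS]invrK lef_pV2 ?posrE ?invr_gt0 ?ltr0n//.
by apply/ltW; rewrite /n truncnS_gt.
Qed.

Lemma natrV_half n : (n.*2%:R : R)^-1 = n%:R^-1 / 2.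
Proof. by rewrite -muln2 natrM invfM. Qed.

Lemma abs_geD f g n :
  abs_ge (f + g) n `<=` abs_ge f n.*2 `|` abs_ge g n.*2.
Proof.
move=> x; rewrite /abs_ge /= natrV_half => fgx.
apply/orP; apply: contraTT fgx; rewrite negb_or -!ltNge => /andP[fx gx].
apply: le_lt_trans (ler_normD _ _) _.
by rewrite [ltRHS](splitr n%:R^-1); exact: ltrD.
Qed.

Lemma Cb1_abs_ge : abs_ge (1 : Cb X R) 1 = [set: X].
Proof. by apply/seteqP; split => // x _; rewrite /abs_ge /= invr1 normr1. Qed.

End Cb_basics.


Lemma Cb_bump (X : topologicalType) (R : realType) (x : X) (U : set X) :
  completely_regular_space X -> nbhs x U ->
  exists2 f : Cb X R, f x = 1 & coz f `<=` U.
Proof.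
move=> crX Ux.
have cU : closed (~` U°) by apply: open_closedC; exact: open_interior.
have /(@uniform_separatorP _ R)[h [ch h01 hx hU]] :=
  crX x _ cU (fun nUx => nUx Ux).
have h1 y : `|1 - h y| <= 1.
  have /h01 : range h (h y) by exists y.
  by rewrite /= in_itv /= => /andP[h0 h1]; rewrite ger0_norm; lra.
have fC : (fun y => 1 - h y) \in @Cb_pred X R.
  apply: Cb_intro h1 => y; apply: cvgB; [exact: cvg_cst|exact: ch].
exists (MkCb fC) => /= [|y fy].
  by have -> : h x = 0 by [apply: hx; exists x]; rewrite subr0.
apply: contrapT => nUy; apply: fy => /=.
have -> : h y = 1; last by rewrite subrr.
by apply: hU; exists y => // /interior_subset.
Qed.

Section C0P_theory.
Variable P : topologicalType -> Prop.
Hypotheses (P_top : topological_property P) (P_closed : closed_hereditary P)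
  (P_sums : preserved_finite_closed_sums P).
Context (R : realType) (X : topologicalType).
Implicit Types f g : Cb X R.

Lemma closed_null_nbhd_has (A : set X) :
  closed A -> has_null_nbhd P A -> subset_has P A.
Proof.
move=> cA [U AU PU]; apply: (subset_has_closed_sub P_top P_closed PU cA).
by move=> x /AU /interior_subset /subset_closure.
Qed.

(** The level set [|f| >= 1/(n+1)] is a closed neighbourhood of the level set
    [|f| >= 1/n]; this is why the null neighbourhoods in the definition of
    [C0P] may be dropped. *)
Lemma C0P_abs_ge : C0P P X R =
  [set f : Cb X R | forall n, (0 < n)%N -> subset_has P (abs_ge f n)].
Proof.
apply/seteqP; split => f fP n n0.
  apply: closed_null_nbhd_has; last exact: fP.
  exact: Cb_abs_ge_closed.
exists (abs_ge f n.+1); first by apply: abs_ge_interior => //; exact: Cb_continuous.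
rewrite /is_null; have /closure_id <- : closed (abs_ge f n.+1).
  exact: Cb_abs_ge_closed.
exact: fP.
Qed.

Lemma C0PP f : C0P P X R f <-> forall n, (0 < n)%N -> subset_has P (abs_ge f n).
Proof. by rewrite C0P_abs_ge. Qed.

Lemma C0P_coz : preserved_countable_closed_sums P ->
  C0P P X R = [set f : Cb X R | subset_has P (coz f)].
Proof.
move=> sumP; apply/seteqP; split => f.
  move=> /C0PP fP; have cozE := coz_abs_ge f.
  apply: (subset_has_bigcup_countable P_top (F := fun n => abs_ge f n.+1)) => //.
    move=> n; split; [exact: Cb_abs_ge_closed| |exact: fP].
    by rewrite cozE => x fx; exists n.+1.
  by rewrite cozE => x [[//|n] _ fx]; exists n.
move=> Pf; apply/C0PP => n n0.
apply: (subset_has_closed_sub P_top P_closed Pf).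
  exact: Cb_abs_ge_closed.
by rewrite coz_abs_ge => x fx; exists n.
Qed.

Lemma C0P_sub f (A : nat -> set X) :
  (forall n, (0 < n)%N -> subset_has P (A n) /\ abs_ge f n `<=` A n) ->
  C0P P X R f.
Proof.
move=> fA; apply/C0PP => n n0; have [PA fAn] := fA n n0.
apply: (subset_has_closed_sub P_top P_closed PA) => //.
exact: Cb_abs_ge_closed.
Qed.

Lemma C0P_ideal : is_ideal (C0P P X R).
Proof.
split=> [|f g /C0PP Pf /C0PP Pg|f g /C0PP Pg].
- apply: (C0P_sub (A := fun=> set0)) => n n0.
  split; first exact: subset_has_set0.
  by move=> x; rewrite /abs_ge /= normr0 leNgt invr_gt0 ltr0n n0.
- apply: (C0P_sub (A := fun n => abs_ge f n.*2 `|` abs_ge g n.*2)) => n n0.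
  split.
    apply: subset_has_setU => //; try exact: Cb_abs_ge_closed.
      by apply: Pf; rewrite double_gt0.
    by apply: Pg; rewrite double_gt0.
  exact: abs_geD.
- pose M := (Num.truncn (supnorm f)).+1.
  have fM x : `|f x| <= M%:R.
    by apply: le_trans (ler_supnorm f x) _; apply/ltW; exact: truncnS_gt.
  apply: (C0P_sub (A := fun n => abs_ge g (n * M)%N)) => n n0.
  split; first by apply: Pg; rewrite muln_gt0 n0.
  move=> x; rewrite /abs_ge /= natrM invfM normrM => fgx.
  rewrite ler_pdivrMr ?ltr0n//; apply: le_trans fgx _.
  by rewrite mulrC ler_wpM2l.
Qed.

Lemma ideal_subalgebra (H : set (Cb X R)) : is_ideal H -> is_subalgebra H.
Proof.
move=> [H0 HD HM]; split => // [a f Hf|f g _]; last exact: HM.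
suff -> : a *: f = (a *: (1 : Cb X R)) * f by exact: HM.
apply/val_inj/funext => x /=.
by rewrite -[LHS]/(a * f x) -[RHS]/((a * 1) * f x) mulr1.
Qed.

Lemma C0P_subalgebra : is_subalgebra (C0P P X R).
Proof. exact: ideal_subalgebra C0P_ideal. Qed.

Lemma C0P_closed : closed (C0P P X R).
Proof.
move=> f clf; apply: (C0P_sub (A := fun n => abs_ge f n)) => n n0.
split => //; have [|g [Cg fg]] := clf (ball f (n.*2%:R^-1)).
  by apply: nbhsx_ballx; rewrite invr_gt0 ltr0n double_gt0.
have /C0PP Pg := Cg.
apply: (subset_has_closed_sub P_top P_closed (Pg n.*2 _)).
- by rewrite double_gt0.
- exact: Cb_abs_ge_closed.
move=> x; rewrite /abs_ge /= natrV_half => fx.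
have {}fg : `|f x - g x| <= n%:R^-1 / 2.
  move: fg; rewrite -ball_normE /= natrV_half => /ltW; apply: le_trans.
  exact: (ler_supnorm (f - g) x).
have := ler_normD (f x - g x) (g x); rewrite subrK; lra.
Qed.

Lemma C00P_sub_C0P : C00P P X R `<=` C0P P X R.
Proof.
move=> f [U fU PU] n n0; exists U => // x fx; apply: fU.
by apply: subset_closure; rewrite coz_abs_ge; exists n.
Qed.

(** A bump function supported in a neighbourhood with the property has level sets
    closed in that neighbourhood.  These functions give the empty hull, force a unit
    to be the constant [1], and place [X] inside [lambda]. *)
Lemma C0P_peak (x : X) : completely_regular_space X -> locally_has P X ->
  exists2 f : Cb X R, C0P P X R f & f x = 1.
Proof.
move=> crX /(_ x)[U Ux PU]; have [f fx fU] := Cb_bump R crX Ux.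
exists f => //; apply/C0PP => n n0.
apply: (subset_has_closed_sub P_top P_closed PU); first exact: Cb_abs_ge_closed.
by move=> y fy; apply: fU; rewrite coz_abs_ge; exists n.
Qed.

Lemma C0P_empty_hull : completely_regular_space X ->
  empty_hull (C0P P X R) <-> locally_has P X.
Proof.
move=> crX; split => [hull x|locP x].
  have [f /C0PP Pf /eqP fx] := hull x.
  have : (\bigcup_(n in [set n | (0 < n)%N]) abs_ge f n) x by rewrite -coz_abs_ge.
  move=> [n n0 /abs_ge_interior fnx]; exists (abs_ge f n.+1); last exact: Pf.
  by apply: fnx => //; exact: Cb_continuous.
by have [f Pf fx] := C0P_peak x crX locP; exists f; rewrite // fx oner_neq0.
Qed.

Lemma C0P_one : C0P P X R 1 <-> P X.
Proof.
split => [/C0PP/(_ 1%N isT)|PX].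
  by rewrite Cb1_abs_ge => /(subset_has_setT P_top).
apply/C0PP => n n0.
apply: (subset_has_closed_sub P_top P_closed (A := setT)) => //.
  exact/subset_has_setT.
exact: Cb_abs_ge_closed.
Qed.

Lemma C0P_unital : completely_regular_space X -> locally_has P X ->
  is_unital (C0P P X R) <-> P X.
Proof.
move=> crX locP; split => [[e Ce eE]|/C0P_one C1]; last first.
  by exists 1 => // f _; rewrite mul1r mulr1.
apply/C0P_one; suff -> : 1 = e by [].
apply/val_inj/funext => x /=; have [f Cf fx] := C0P_peak x crX locP.
have [/(congr1 (fun h : Cb X R => h x)) + _] := eE f Cf.
by rewrite /= -[LHS]/(e x * f x) fx mulr1.
Qed.

(** Shrinking the values of [f] towards zero by [1/n] gives a function supported in
    the level set [|f| >= 1/n], at distance at most [1/n] from [f]. *)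
Lemma C00P_dense : C0P P X R `<=` closure (C00P P X R).
Proof.
move=> f Cf U /nbhs_ballP[e /= e0 feU].
pose n := (Num.truncn e^-1).+1.
have n0 : (0 : R) < n%:R^-1 by rewrite invr_gt0 ltr0n.
have ne : n%:R^-1 < e.
  by rewrite -[ltRHS]invrK ltf_pV2 ?posrE ?invr_gt0 ?ltr0n// truncnS_gt.
(* [clip] is [f] followed by the retraction of the line onto [-1/n, 1/n]. *)
pose clip (x : X) : R := Order.max (- n%:R^-1) (Order.min (f x) n%:R^-1).
have clipP x : `|clip x| <= n%:R^-1.
  rewrite /clip ler_norml le_max lexx/= ge_max ge_min lexx orbT andbT.
  by rewrite (le_trans _ (ltW n0))// oppr_le0 ltW.
have cclip : continuous clip.
  move=> x; apply: (@continuous_max _ _ (fun=> - n%:R^-1)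
      (fun y => Order.min (f y) n%:R^-1) x); first exact: cvg_cst.
  apply: (@continuous_min _ _ f (fun=> n%:R^-1) x); last exact: cvg_cst.
  exact: Cb_continuous.
pose c := MkCb (Cb_intro cclip clipP).
exists (f - c); split.
  suff fc : coz (f - c) `<=` abs_ge f n.
    have [V fV PV] := Cf n isT; exists V => //; apply: subset_trans fV.
    have /closure_id -> : closed (abs_ge f n) by exact: Cb_abs_ge_closed.
    exact: closureS.
  move=> x; apply: contra_notT; rewrite /abs_ge /= -ltNge ltr_norml => /andP[f1 f2].
  rewrite -[LHS]/(f x - clip x) /clip minElt f2 maxElt f1; lra.
apply: feU; rewrite -ball_normE /= opprB addrC subrK.
by apply: le_lt_trans ne; apply: supnorm_le => //; exact: ltW.
Qed.

End C0P_theory.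

(** * Characters of C0 *)

(** Compactness as an induction principle: the sets whose complement in [K]
    satisfies [Q] form a filter, and a cluster point of that filter in [K] would
    have no neighbourhood satisfying [Q]. *)
Lemma compact_induction (T : topologicalType) (K : set T)
    (Q : set T -> Prop) : compact K -> Q set0 ->
  (forall A B, Q A -> Q B -> Q (A `|` B)) ->
  (forall A B, A `<=` B -> Q B -> Q A) ->
  (forall p, K p -> exists2 U, nbhs p U & Q U) -> Q K.
Proof.
move=> cK Q0 QU Qsub Qloc; apply: contrapT => nQK.
pose F : set_system T := [set A | Q (K `\` A)].
have FF : ProperFilter F.
  split; first by rewrite /F /= setD0.
  split; first by rewrite /F /= setDT.
    by move=> A B FA FB; rewrite /F /= setDIr; exact: QU.
  by move=> A B AB; apply: Qsub; exact: setDS.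
have [|p [Kp pF]] := cK F FF; first by rewrite /F /= setDv.
have [U pU QUp] := Qloc p Kp.
have FCU : F (~` U) by rewrite /F /= setDE setCK; apply: Qsub QUp; exact: subIsetr.
by have [q []] := pF _ _ FCU pU.
Qed.

Section C0_theory.
Context (Z : topologicalType) (R : realType).
Implicit Types f g : Cb Z R.

Lemma C0_sub f (K : nat -> set Z) :
  (forall n, (0 < n)%N -> compact (K n) /\ abs_ge f n `<=` K n) -> C0 Z R f.
Proof.
move=> fK n n0; have [cK fKn] := fK n n0.
by apply: (subclosed_compact _ cK) => //; exact: Cb_abs_ge_closed.
Qed.

Lemma C0_dominated f g (M : R) : C0 Z R g ->
  (forall z, `|f z| <= M * `|g z|) -> C0 Z R f.
Proof.
move=> C0g fg; pose N := (Num.truncn M).+1.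
apply: (C0_sub (K := fun n => abs_ge g (n * N)%N)) => n n0; split.
  by apply: C0g; rewrite muln_gt0 n0.
move=> z; rewrite /abs_ge /= natrM invfM ler_pdivrMr ?ltr0n// => fz.
apply: le_trans fz _; apply: le_trans (fg z) _.
by rewrite mulrC ler_wpM2l// ltW// truncnS_gt.
Qed.

Lemma C0_0 : C0 Z R 0.
Proof.
apply: (C0_sub (K := fun=> set0)) => n n0; split; first exact: compact0.
by move=> x; rewrite /abs_ge /= normr0 leNgt invr_gt0 ltr0n n0.
Qed.

Lemma C0D f g : C0 Z R f -> C0 Z R g -> C0 Z R (f + g).
Proof.
move=> C0f C0g.
apply: (C0_sub (K := fun n => abs_ge f n.*2 `|` abs_ge g n.*2)) => n n0.
split; first by apply: compactU; [apply: C0f|apply: C0g]; rewrite double_gt0.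
exact: abs_geD.
Qed.

Lemma C0Z (a : R) f : C0 Z R f -> C0 Z R (a *: f).
Proof.
by move=> C0f; apply: (C0_dominated (M := `|a|) C0f) => z; rewrite -normrM.
Qed.

Lemma C0M f g : C0 Z R f -> C0 Z R g -> C0 Z R (f * g).
Proof.
move=> _ C0g; apply: (C0_dominated (M := supnorm f) C0g) => z.
by rewrite normrM ler_wpM2r// ler_supnorm.
Qed.

Lemma C0_quotient f (v : Z -> R) (m : R) : C0 Z R f -> continuous v ->
  0 < m -> (forall z, m <= v z) ->
  exists2 g, C0 Z R g & forall z, g z = f z / v z.
Proof.
move=> C0f cv m0 mv.
have v0 z : 0 < v z by apply: lt_le_trans (mv z).
have fv z : `|f z / v z| <= m^-1 * `|f z|.
  rewrite normrM normfV (gtr0_norm (v0 z)) mulrC ler_wpM2r//.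
  by rewrite lef_pV2 ?posrE.
have gC : (fun z => f z / v z) \in @Cb_pred Z R.
  apply: (@Cb_intro _ _ _ (m^-1 * supnorm f)) => z.
    apply: cvgM; first exact: Cb_continuous.
    by apply: cvgV; [rewrite gt_eqF|exact: cv].
  by apply: le_trans (fv z) _; rewrite ler_wpM2l ?invr_ge0 ?(ltW m0)// ler_supnorm.
by exists (MkCb gC) => //; exact: (@C0_dominated (MkCb gC) f m^-1).
Qed.

Definition is_character (chi : Cb Z R -> R) :=
  [/\ (forall f g, C0 Z R f -> C0 Z R g -> chi (f + g) = chi f + chi g),
      (forall (a : R) f, C0 Z R f -> chi (a *: f) = a * chi f),
      (forall f g, C0 Z R f -> C0 Z R g -> chi (f * g) = chi f * chi g)
    & (exists2 e, C0 Z R e & chi e != 0)].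

(** A function [w] of norm less than one cannot have character value one, since
    [g = w / (1 - w)] would satisfy [g = w + g w]. *)
Lemma character_neq1 chi w : is_character chi -> C0 Z R w ->
  (forall z, `|w z| <= 2^-1) -> chi w != 1.
Proof.
move=> [chiD _ chiM _] C0w w1; apply/eqP => chiw.
have h0 : (0 : R) < 2^-1 by rewrite invr_gt0.
have [|z|g C0g gE] := @C0_quotient w (fun z => 1 - w z) 2^-1 C0w _ h0 _.
- by move=> z; apply: cvgB; [exact: cvg_cst|exact: Cb_continuous].
- by have := w1 z; rewrite ler_norml; lra.
have gw : g = w + g * w.
  apply/val_inj/funext => z; rewrite /= -[RHS]/(w z + g z * w z) gE.
  by field; have := w1 z; rewrite ler_norml => ?; apply/eqP; lra.
have := chiD _ _ C0w (C0M C0g C0w); rewrite -gw chiM// chiw mulr1.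
lra.
Qed.

(** The point is a common zero of the kernel.  If the members of the kernel had no
    common zero on the compact set where [u = e^2 >= 1/2], for some [e] of value
    one, then a sum [s] of squares of members of the kernel would be bounded below
    there by a positive constant [m]; subtracting from [u] the multiple
    [s u / max(s, m)] of [s] would leave a function of norm at most [1/2] and of
    character value one. *)
Lemma character_eval chi : is_character chi ->
  exists z, forall f, C0 Z R f -> chi f = f z.
Proof.
move=> chiP; have [chiD chiZ chiM [e0 C0e0 chie0]] := chiP.
have chi0 : chi 0 = 0 by rewrite -(scale0r (0 : Cb Z R)) chiZ ?mul0r//; exact: C0_0.
pose e := (chi e0)^-1 *: e0; pose u := e * e.
have C0e : C0 Z R e by exact: C0Z.
have C0u : C0 Z R u by exact: C0M.
have chie : chi e = 1 by rewrite chiZ// mulVf.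
have chiu : chi u = 1 by rewrite chiM// chie mulr1.
have u0 z : 0 <= u z by exact: sqr_ge0.
pose K := abs_ge u 2.
have [[z Kz zP]|noz] := pselect (exists2 z, K z &
    forall f, C0 Z R f -> chi f = 0 -> f z = 0).
  have fE f : C0 Z R f -> f z = chi f * e z.
    move=> C0f; have C0k := C0Z (a := - chi f) C0e.
    have : (f + (- chi f) *: e) z = 0.
      by apply: zP; [exact: C0D|rewrite chiD// chiZ// chie mulr1 subrr].
    by rewrite -[LHS]/(f z + (- chi f) * e z) => fz; lra.
  have ez : e z = 1.
    have := fE u C0u; rewrite chiu mul1r => uz.
    have e_n0 : e z != 0.
      apply: contraTneq (Kz : is_true (2%:R^-1 <= `|u z|)) => ez0.
      by rewrite uz ez0 normr0 -ltNge invr_gt0.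
    by apply: (mulfI e_n0); rewrite mulr1.
  by exists z => f /fE ->; rewrite ez mulr1.
exfalso.
(* Squares of members of the kernel give [Q] near each point of [K], and sums pass
   it on to unions. *)
pose Q (A : set Z) := exists s, [/\ C0 Z R s, chi s = 0, forall z, 0 <= s z &
  exists2 m, 0 < m & forall z, A z -> m <= s z].
have [s [C0s chis s0 [m m0 sm]]] : Q K.
  apply: compact_induction.
  - exact: C0u.
  - by exists 0; split => //; [exact: C0_0|exists 1].
  - move=> A B [s [C0s chis s0 [m m0 sm]]] [t [C0t chit t0 [l l0 tl]]].
    exists (s + t); split; first exact: C0D.
    + by rewrite chiD// chis chit addr0.
    + by move=> z; exact: (addr_ge0 (s0 z) (t0 z)).
    + exists (Order.min m l) => [|z]; first by rewrite lt_min m0.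
      rewrite -[leRHS]/(s z + t z) ge_min => -[/sm|/tl] ?; apply/orP.
        by left; rewrite ler_wpDr.
      by right; rewrite ler_wpDl.
  - move=> A B AB [s [C0s chis s0 [m m0 sm]]]; exists s; split => //.
    by exists m => // z /AB; exact: sm.
  - move=> z Kz; have [f [C0f chif fz]] : exists f, [/\ C0 Z R f, chi f = 0 & f z <> 0].
      apply: contrapT => nof; apply: noz; exists z => // f C0f chif.
      by apply: contrapT => fz; apply: nof; exists f.
    have fz0 : 0 < f z * f z by rewrite -expr2 exprn_even_gt0//=; exact/eqP.
    exists [set y | f z * f z / 2 < `|(f * f) y|].
      apply: open_nbhs_nbhs; split.
        by apply: abs_gt_open; exact: Cb_continuous.
      by rewrite /= -[X in `|X|]/(f z * f z) gtr0_norm; lra.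
    exists (f * f); split; first exact: C0M.
    + by rewrite chiM// chif mulr0.
    + by move=> y; exact: sqr_ge0.
    + exists (f z * f z / 2) => [|y /=]; first by lra.
      by rewrite ger0_norm ?sqr_ge0// => /ltW.
(* [k] is such that [s k] agrees with [u] on [K] and lies between [0] and [u]
   elsewhere. *)
have [|y|k C0k kE] := @C0_quotient u (fun z => Order.max (s z) m) m C0u _ m0 _.
- move=> z; apply: (@continuous_max _ _ s (fun=> m) z); last exact: cvg_cst.
  exact: Cb_continuous.
- by rewrite le_max lexx orbT.
have C0sk := C0Z (a := -1) (C0M C0s C0k).
have : chi (u + (-1) *: (s * k)) != 1.
  apply: character_neq1 => //; first exact: C0D.
  move=> z; rewrite -[X in `|X|]/(u z + (-1) * (s z * k z)) kE.
  have [ms|sm'] := leP m (s z).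
    rewrite (_ : _ + _ = 0) ?normr0 ?invr_ge0//; field.
    by rewrite gt_eqF//; exact: lt_le_trans ms.
  have uz : u z <= 2^-1.
    rewrite leNgt; apply/negP => uz; move: sm'; rewrite ltNge => /negP; apply.
    by apply: sm; rewrite -[K z]/(is_true (2^-1 <= `|u z|)) ger0_norm// ltW.
  have -> : u z + -1 * (s z * (u z / m)) = u z * (1 - s z / m).
    by field; rewrite gt_eqF.
  have sm1 : s z / m <= 1 by rewrite ler_pdivrMr// mul1r ltW.
  have sm0 : 0 <= s z / m by rewrite divr_ge0// ltW.
  have sm2 : 0 <= 1 - s z / m by rewrite subr_ge0.
  rewrite (ger0_norm (mulr_ge0 (u0 z) sm2)); apply: le_trans uz.
  by rewrite ler_piMr//; lra.
rewrite chiD// chiZ; last exact: C0M.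
by rewrite chiM// chis chiu mul0r mulr0 addr0 eqxx.
Qed.

End C0_theory.

(** * The space is determined by its algebra C0 *)

(** The body of [isometrically_isomorphic] with the map named, so that inverses
    and composites can be formed and the point maps be attached to it. *)
Definition isometric_isomorphism (X Y : topologicalType) (R : realType)
    (A : set (Cb X R)) (B : set (Cb Y R)) (phi : Cb X R -> Cb Y R) :=
  [/\ set_bij A B phi,
      (forall f g, A f -> A g -> phi (f + g) = phi f + phi g),
      (forall (a : R) f, A f -> phi (a *: f) = a *: phi f),
      (forall f g, A f -> A g -> phi (f * g) = phi f * phi g)
    & (forall f, A f -> `|phi f| = `|f|)].

Lemma isometric_isomorphism_inv (X Y : topologicalType) (R : realType)
    (A : set (Cb X R)) (B : set (Cb Y R)) phi :
  is_subalgebra A -> isometric_isomorphism A B phi ->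
  exists psi, [/\ isometric_isomorphism B A psi,
    (forall f, A f -> psi (phi f) = f) & (forall g, B g -> phi (psi g) = g)].
Proof.
move=> [_ AD AZ AM] [[phiA phi_inj phi_surj] phiD phiZ phiM phi_norm].
have /choice[psi psiP] (g : Cb Y R) : exists f, B g -> A f /\ phi f = g.
  have [Bg|nBg] := pselect (B g); last by exists 0.
  by have [f Af fg] := phi_surj g Bg; exists f.
have psiA g : B g -> A (psi g) by move=> /psiP[].
have psiK g : B g -> phi (psi g) = g by move=> /psiP[].
have phiK f : A f -> psi (phi f) = f.
  by move=> Af; apply: phi_inj; rewrite ?inE ?psiK//; [apply: psiA|]; exact: phiA.
exists psi; split => //; split.
- split; first exact: psiA.
    by move=> f g /set_mem Bf /set_mem Bg fg; rewrite -(psiK f)// -(psiK g)// fg.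
  by move=> f Af; exists (phi f); [exact: phiA|exact: phiK].
- move=> f g Bf Bg; rewrite -[in LHS](psiK f)// -[in LHS](psiK g)//.
  by rewrite -phiD ?phiK//; [apply: AD|..]; exact: psiA.
- move=> a f Bf; rewrite -[in LHS](psiK f)//.
  by rewrite -phiZ ?phiK//; [apply: AZ|..]; exact: psiA.
- move=> f g Bf Bg; rewrite -[in LHS](psiK f)// -[in LHS](psiK g)//.
  by rewrite -phiM ?phiK//; [apply: AM|..]; exact: psiA.
- by move=> f Bf; rewrite -phi_norm ?psiK//; exact: psiA.
Qed.

Lemma isometric_isomorphism_comp (X Y Z : topologicalType) (R : realType)
    (A : set (Cb X R)) (B : set (Cb Y R)) (C : set (Cb Z R)) phi psi :
  isometric_isomorphism A B phi -> isometric_isomorphism B C psi ->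
  isometric_isomorphism A C (psi \o phi).
Proof.
move=> [bphi phiD phiZ phiM phi_norm] [bpsi psiD psiZ psiM psi_norm].
have [phiA _ _] := bphi.
split => [|f g Af Ag|a f Af|f g Af Ag|f Af] /=.
- exact: set_bij_comp bpsi.
- by rewrite phiD// psiD//; exact: phiA.
- by rewrite phiZ// psiZ//; exact: phiA.
- by rewrite phiM// psiM//; exact: phiA.
- by rewrite psi_norm ?phi_norm//; exact: phiA.
Qed.

Lemma C0_subalgebra (Z : topologicalType) (R : realType) :
  is_subalgebra (C0 Z R).
Proof. by split=> *; [exact: C0_0|exact: C0D|exact: C0Z|exact: C0M]. Qed.

Lemma C0_bump (Z : topologicalType) (R : realType) (z : Z) (U : set Z) :
  locally_compact [set: Z] -> hausdorff_space Z -> nbhs z U ->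
  exists f, [/\ C0 Z R f, f z = 1 & coz f `<=` U].
Proof.
move=> lcZ hZ zU.
have [K zK [cK _]] := lcZ z I.
have {}zK : nbhs z K by move: zK; rewrite /within/=; apply: filterS => y; exact.
have crZ := @locally_compact_completely_regular _ R lcZ hZ.
have [f fz fUK] := Cb_bump R crZ (filterI zU zK).
exists f; split => //; last by move=> y /fUK[].
apply: (C0_sub (K := fun=> K)) => n n0; split => // y fy.
have [] // : (U `&` K) y; apply: fUK; rewrite coz_abs_ge; by exists n.
Qed.

(** Following an isomorphism by evaluation at a point of [Z] gives a character of
    [C0 Y]; it is nonzero because [Z] has bump functions at each point. *)
Lemma point_map_of_isomorphism (Y Z : topologicalType) (R : realType)
    (phi : Cb Y R -> Cb Z R) :
  locally_compact [set: Z] -> hausdorff_space Z ->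
  isometric_isomorphism (C0 Y R) (C0 Z R) phi ->
  exists tau : Z -> Y, forall f z, C0 Y R f -> phi f z = f (tau z).
Proof.
move=> lcZ hZ [[_ _ phi_surj] phiD phiZ phiM _].
suff /choice[tau tauP] (z : Z) : exists y, forall f, C0 Y R f -> phi f z = f y.
  by exists tau => f z C0f; exact: tauP.
apply: (@character_eval _ _ (fun f => phi f z)); split.
- by move=> f g C0f C0g; rewrite phiD.
- by move=> a f C0f; rewrite phiZ.
- by move=> f g C0f C0g; rewrite phiM.
- have [g [C0g gz _]] := C0_bump R lcZ hZ (filterT (F := nbhs z)).
  by have [f C0f fg] := phi_surj g C0g; exists f; rewrite // fg gz oner_neq0.
Qed.

Lemma C0_separates (Y : topologicalType) (R : realType) (y1 y2 : Y) :
  locally_compact [set: Y] -> hausdorff_space Y ->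
  (forall f, C0 Y R f -> f y1 = f y2) -> y1 = y2.
Proof.
move=> lcY hY y12; apply: contrapT => ne.
have [|f [C0f fy1 fU]] := @C0_bump Y R y1 (~` [set y2]) lcY hY.
  apply: open_nbhs_nbhs; split => //; apply: closed_openC.
  exact: accessible_closed_set1 (hausdorff_accessible hY) y2.
apply: (fU y2) => // fy2.
by have := y12 f C0f; rewrite fy1 fy2 => /eqP; rewrite oner_eq0.
Qed.

(** The cozero-sets of the members of [C0] form a base of a locally compact
    Hausdorff space. *)
Lemma C0_continuous (Y Z : topologicalType) (R : realType) (tau : Z -> Y) :
  locally_compact [set: Y] -> hausdorff_space Y ->
  (forall f, C0 Y R f -> continuous (f \o tau)) -> continuous tau.
Proof.
move=> lcY hY ftau z U tauzU.
have [f [C0f fz fU]] := C0_bump R lcY hY tauzU.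
rewrite nbhs_simpl/=; have oV := abs_gt_open 0 (ftau f C0f).
apply: (@filterS _ _ _ [set x | 0 < `|(f \o tau) x|]).
  by move=> x /= fx; apply: fU => /= fx0; move: fx; rewrite fx0 normr0 ltxx.
by apply: open_nbhs_nbhs; split => //=; rewrite fz normr1.
Qed.

(** The isomorphism and its inverse are both given by composition with maps of
    points, which are then inverse to each other. *)
Lemma C0_isomorphic_homeomorphic (Y Z : topologicalType) (R : realType) :
  locally_compact [set: Y] -> hausdorff_space Y ->
  locally_compact [set: Z] -> hausdorff_space Z ->
  isometrically_isomorphic (C0 Y R) (C0 Z R) -> homeomorphic Z Y.
Proof.
move=> lcY hY lcZ hZ [phi iphi].
have [psi [ipsi phiK psiK]] := isometric_isomorphism_inv (@C0_subalgebra _ _) iphi.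
have [tau tauP] := point_map_of_isomorphism lcZ hZ iphi.
have [sigma sigmaP] := point_map_of_isomorphism lcY hY ipsi.
have [[phi_fun _ _] _ _ _ _] := iphi; have [[psi_fun _ _] _ _ _ _] := ipsi.
exists tau, sigma; split.
- apply: (@C0_continuous _ _ R) => // f C0f.
  have -> : f \o tau = phi f by apply/funext => z /=; rewrite tauP.
  exact: Cb_continuous.
- apply: (@C0_continuous _ _ R) => // f C0f.
  have -> : f \o sigma = psi f by apply/funext => y /=; rewrite sigmaP.
  exact: Cb_continuous.
- move=> z; apply: (@C0_separates Z R) => // g C0g.
  by rewrite -sigmaP// -tauP ?psiK//; exact: psi_fun.
- move=> y; apply: (@C0_separates Y R) => // f C0f.
  by rewrite -tauP// -sigmaP ?phiK//; exact: phi_fun.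
Qed.

(** * The space lambda and the isomorphism *)

Lemma dense_eq (T : topologicalType) (R : realType) (D : set T) (u v : T -> R) :
  dense D -> continuous u -> continuous v -> (forall x, D x -> u x = v x) ->
  u = v.
Proof.
move=> dD cu cv uv; apply/funext => x; apply: contrapT => /eqP uvx.
have cuv : continuous (fun y => u y - v y).
  by move=> y; apply: cvgB; [exact: cu|exact: cv].
have [|y [/= uvy Dy]] := dD [set y | 0 < `|u y - v y|] _ (abs_gt_open 0 cuv).
  by exists x => /=; rewrite normr_gt0 subr_eq0.
by move: uvy; rewrite (uv y)// subrr normr0 ltxx.
Qed.

Lemma dense_le (T : topologicalType) (R : realType) (D : set T) (u : T -> R)
    (M : R) : dense D -> continuous u -> (forall x, D x -> `|u x| <= M) ->
  forall x, `|u x| <= M.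
Proof.
move=> dD cu uM x; rewrite leNgt; apply/negP => Mx.
have [|y [/= uy Dy]] := dD [set y | M < `|u y|] _ (abs_gt_open M cu).
  by exists x.
by move: (uM y Dy); rewrite leNgt uy.
Qed.

Lemma compact_set_val_preimage (T : topologicalType) (A K : set T) :
  compact K -> K `<=` A -> compact ((set_val : set_type A -> T) @^-1` K).
Proof.
move=> cK KA F FF FK.
have [|p [Kp Fp]] := cK (set_val @ F) _; first exact: FK.
exists (exist _ p (mem_set (KA p Kp))); split => // U V FU.
rewrite nbhsE => -[_ [[W oW <-] Wp] WV].
have [q [[y Uy yq] Wq]] : (set_val @` U) `&` W !=set0.
  apply: Fp; last exact: open_nbhs_nbhs.
  by rewrite /= nbhs_simpl; apply: filterS FU => y Uy; exists y.
by exists y; split => //; apply: WV => /=; rewrite yq.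
Qed.

Lemma open_subspace_locally_compact (T : topologicalType) (A : set T) :
  hausdorff_space T -> compact [set: T] -> open A ->
  locally_compact [set: set_type A].
Proof.
move=> hT cT oA a _.
have [V aV VA] : exists2 V, nbhs (set_val a) V & closure V `<=` A.
  have nA : nbhs (set_val a) A by apply: open_nbhs_nbhs; split => //; exact: set_valP.
  have [V aV VA] := compact_regular (x := set_val a) hT cT filterT nA.
  by exists V.
exists (set_val @^-1` closure V).
  have aV' : nbhs a ((set_val : set_type A -> T) @^-1` V).
    exact: continuous_set_val aV.
  rewrite /within /=; apply: filterS aV' => y Vy _.
  exact: subset_closure.
split; last by apply: closed_set_val_preimage; exact: closed_closure.
apply: compact_set_val_preimage => //.
exact: (subclosed_compact (@closed_closure _ V) cT).
Qed.

Section stone_cech_extension.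
Context (X : topologicalType) (R : realType).
Implicit Types f g : Cb X R.
Local Notation beta := (stone_cech X R).
Local Notation iota := (to_stone_cech X R).

Definition sc_ext f (p : beta) : R := set_val p f.

Lemma sc_ext_continuous f : continuous (sc_ext f).
Proof.
move=> p; have c1 := @continuous_set_val _ _ p.
have c2 := @proj_continuous _ (fun _ : Cb X R => R : topologicalType) f (set_val p).
exact: cvg_comp c1 c2.
Qed.

Lemma sc_ext_iota f x : sc_ext f (iota x) = f x.
Proof. by []. Qed.

(** The set on the left is open and the image of [X] is dense in [beta]. *)
Lemma sc_ext_gt_closure f (a : R) :
  [set p | a < `|sc_ext f p|] `<=` closure (iota @` [set x | a < `|f x|]).
Proof.
move=> p pa W; rewrite nbhsE => -[V [oV Vp] VW].
have oF := abs_gt_open a (@sc_ext_continuous f).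
have [||q [[/= qa Vq] [x _ xq]]] :=
  @to_stone_cech_dense X R ([set p | a < `|sc_ext f p|] `&` V).
- by exists p.
- exact: openI.
exists q; split; last exact: VW.
by exists x => //=; rewrite -sc_ext_iota xq.
Qed.

Hypothesis crhX : completely_regular_hausdorff X.

Lemma iota_continuous : continuous iota.
Proof.
by apply/continuousP => V oV; apply/(to_stone_cech_embedding R crhX).2; exists V.
Qed.

Lemma iota_closure (C : set X) : iota @^-1` closure (iota @` C) `<=` closure C.
Proof.
move=> x xC; apply: contrapT => nxC.
have /(to_stone_cech_embedding R crhX).2[V oV CV] : open (~` closure C).
  by apply: closed_openC; exact: closed_closure.
have [] := xC V; first apply: open_nbhs_nbhs.
  by split => //; rewrite -[V _]/((iota @^-1` V) x) -CV.
move=> _ [[z Cz <-] Vz].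
have : (~` closure C) z by rewrite CV.
by apply; exact: subset_closure.
Qed.

End stone_cech_extension.

Section lambda.
Variable P : topologicalType -> Prop.
Hypotheses (P_top : topological_property P) (P_closed : closed_hereditary P)
  (P_sums : preserved_finite_closed_sums P).
Context (R : realType) (X : topologicalType).
Hypotheses (crhX : completely_regular_hausdorff X) (locP : locally_has P X).
Implicit Types f g : Cb X R.
Local Notation beta := (stone_cech X R).
Local Notation iota := (to_stone_cech X R).
Local Notation lambda := (lambda_set P X R).
Local Notation Y := (lambda_space P X R).

Lemma is_cozero_abs_gt f (a : R) : is_cozero R [set x | a < `|f x|].
Proof.
exists (fun x => Order.max (`|f x| - a) 0).
  move=> x; apply: (@continuous_max _ _ (fun x => `|f x| - a) (fun=> 0) x).
    by apply: cvgB; [apply: cvg_norm; exact: Cb_continuous|exact: cvg_cst].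
  exact: cvg_cst.
apply/seteqP; split => x; rewrite /coz /=.
  by rewrite -subr_gt0 => fa; rewrite maxEle leNgt fa /=; apply/eqP; rewrite gt_eqF.
by apply: contra_notT; rewrite -leNgt -subr_le0 => /max_idPr.
Qed.

(** Choose [n] with [|F p| >= 1/n], where [F] extends [f].  The cozero-set
    [|f| > 1/(n+1)] then witnesses that [p] belongs to [lambda]: its closure lies in
    a level set of [f], which has a null neighbourhood, and the closure of its image
    contains the open set [|F| > 1/(n+1)]. *)
Lemma sc_ext_lambda f p : C0P P X R f -> sc_ext f p != 0 -> lambda p.
Proof.
move=> Cf /eqP fp.
have : (\bigcup_(n in [set n | (0 < n)%N]) abs_ge (sc_ext f) n) p.
  by rewrite -coz_abs_ge.
move=> [n /= n0 fnp].
exists [set x | n.+1%:R^-1 < `|f x|].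
  split; first exact: is_cozero_abs_gt.
  have [U fU PU] := Cf n.+1 isT; exists U => //; apply: subset_trans fU.
  have /closure_id -> : closed (abs_ge f n.+1) by exact: Cb_abs_ge_closed.
  by apply: closureS => x /= /ltW.
apply: (@interiorS _ [set q | n.+1%:R^-1 < `|sc_ext f q|]).
  exact: sc_ext_gt_closure.
apply: open_nbhs_nbhs; split; first exact/abs_gt_open/sc_ext_continuous.
apply: lt_le_trans fnp.
by rewrite ltf_pV2 ?posrE ?ltr0n// ltr_nat.
Qed.

Lemma iota_lambda : range iota `<=` lambda.
Proof.
move=> _ [x _ <-]; have [f Cf fx] := C0P_peak P_top P_closed R x crhX.1 locP.
by apply: (sc_ext_lambda Cf); rewrite sc_ext_iota fx oner_neq0.
Qed.

Lemma lambda_open : open lambda.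
Proof. by apply: bigcup_open => C _; exact: open_interior. Qed.

(** The local fact about [lambda] that compactness turns into a statement on
    compact level sets. *)
Lemma lambda_locally_null p : lambda p -> exists U D,
  [/\ nbhs p U, closed D, subset_has P D & iota @^-1` U `<=` D].
Proof.
move=> [C [_ nullC] Cp]; exists (closure (iota @` C)), (closure C); split => //.
- exact: closed_closure.
- exact: (closed_null_nbhd_has P_top P_closed (@closed_closure _ C)).
- exact: iota_closure.
Qed.

Lemma lambda_locally_compact : locally_compact [set: Y].
Proof.
apply: open_subspace_locally_compact; [exact: stone_cech_hausdorff| |].
  exact: stone_cech_compact.
exact: lambda_open.
Qed.

Lemma lambda_hausdorff : hausdorff_space Y.
Proof.
move=> p q pq; apply: val_inj; apply: (@stone_cech_hausdorff X R) => U V pU qV.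
have [y [Uy Vy]] := pq _ _ (continuous_set_val pU) (continuous_set_val qV).
by exists (set_val y).
Qed.

Definition to_lambda (x : X) : Y :=
  exist _ (iota x) (mem_set (iota_lambda (imageT iota x))).

Lemma to_lambda_continuous : continuous to_lambda.
Proof. apply: continuous_to_subtype; exact: iota_continuous. Qed.

Lemma to_lambda_dense : dense (range to_lambda).
Proof.
move=> O [y Wy] [W oW WO].
have [|q [Wq [x _ xq]]] := @to_stone_cech_dense X R W _ oW.
  by exists (set_val y); move: Wy; rewrite -WO.
by exists (to_lambda x); split; [rewrite -WO -[_ _]/(W (iota x)) xq|exists x].
Qed.

Lemma lambda_ext_in f : sc_ext f \o set_val \in @Cb_pred Y R.
Proof.
have cf : continuous (sc_ext f \o (set_val : Y -> beta)).
  move=> y; apply: continuous_comp; first exact: continuous_set_val.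
  exact: sc_ext_continuous.
apply: (Cb_intro (M := supnorm f)) => //.
apply: dense_le to_lambda_dense cf _ => _ [x _ <-].
exact: ler_supnorm.
Qed.

Definition lambda_ext f : Cb Y R := MkCb (lambda_ext_in f).

Lemma lambda_ext_to_lambda f x : lambda_ext f (to_lambda x) = f x.
Proof. by []. Qed.

(** Since [X] is dense in [Y], compatibility of the extension with the algebra
    operations only has to be checked on [X]. *)
Lemma Cb_lambda_eq (u v : Cb Y R) :
  (forall x, u (to_lambda x) = v (to_lambda x)) -> u = v.
Proof.
move=> uv; apply/val_inj.
apply: dense_eq to_lambda_dense (@Cb_continuous _ _ u) (@Cb_continuous _ _ v) _.
by move=> _ [x _ <-]; exact: uv.
Qed.

(** One direction rests on the extension vanishing outside [lambda], so that its
    level sets in the compact space [beta] lie in [lambda]; the other on covering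
    a compact level set by finitely many of the sets that make up [lambda]. *)
Lemma lambda_ext_C0 f : C0 Y R (lambda_ext f) <-> C0P P X R f.
Proof.
split=> [C0f|Cf n n0].
  apply/(C0PP P_top P_closed) => n n0.
  (* [Q] passes to unions because the property passes to unions of two closed
     sets. *)
  pose Q (A : set Y) := exists D,
    [/\ closed D, subset_has P D & to_lambda @^-1` A `<=` D].
  have [D [_ PD fD]] : Q (abs_ge (lambda_ext f) n).
    apply: compact_induction; first exact: C0f.
    - by exists set0; split; [exact: closed0|exact: subset_has_set0|].
    - move=> A B [D [cD PD AD]] [E [cE PE BE]]; exists (D `|` E).
      split; [exact: closedU|exact: subset_has_setU|].
      by move=> x [/AD|/BE]; [left|right].
    - by move=> A B AB [D [cD PD BD]]; exists D; split => // x /AB; exact: BD.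
    - move=> y _; have [U [D [yU cD PD UD]]] := lambda_locally_null (set_valP y).
      exists (set_val @^-1` U); first exact: continuous_set_val yU.
      by exists D.
  apply: (subset_has_closed_sub P_top P_closed PD) => //.
  exact: Cb_abs_ge_closed.
have -> : abs_ge (lambda_ext f) n = set_val @^-1` abs_ge (sc_ext f) n by [].
apply: compact_set_val_preimage.
  apply: (subclosed_compact _ (@stone_cech_compact X R)) => //.
  by apply: abs_ge_closed; exact: sc_ext_continuous.
move=> p fp; apply: (sc_ext_lambda Cf).
by apply: contraTneq fp => fp0; rewrite /abs_ge /= fp0 normr0 -ltNge invr_gt0 ltr0n.
Qed.

Lemma lambda_ext_isometric :
  isometric_isomorphism (C0P P X R) (C0 Y R) lambda_ext.
Proof.
split; first split.
- by move=> f /lambda_ext_C0.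
- move=> f g _ _ fg; apply/val_inj/funext => x /=.
  by rewrite -!lambda_ext_to_lambda fg.
- move=> g C0g; have cg : continuous (g \o to_lambda).
    move=> x; apply: continuous_comp; first exact: to_lambda_continuous.
    exact: Cb_continuous.
  have gM x : `|(g \o to_lambda) x| <= supnorm g by exact: ler_supnorm.
  pose f := MkCb (Cb_intro cg gM).
  have fg : lambda_ext f = g by exact: Cb_lambda_eq.
  by exists f => //; apply/lambda_ext_C0; rewrite fg.
- by move=> f g _ _; exact: Cb_lambda_eq.
- by move=> a f _; exact: Cb_lambda_eq.
- by move=> f g _ _; exact: Cb_lambda_eq.
- move=> f _; apply/eqP; rewrite eq_le; apply/andP; split.
    apply: supnorm_le; first exact: supnorm_ge0.
    apply: dense_le to_lambda_dense (@Cb_continuous _ _ (lambda_ext f)) _.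
    by move=> _ [x _ <-]; exact: (ler_supnorm f x).
  apply: supnorm_le; first exact: supnorm_ge0.
  by move=> x; exact: (ler_supnorm (lambda_ext f) (to_lambda x)).
Qed.

Lemma lambda_compact : P X <-> compact [set: Y].
Proof.
have e1 : lambda_ext 1 = 1 by exact: Cb_lambda_eq.
split => [/(C0P_one P_top P_closed R)/lambda_ext_C0|cY].
  by rewrite e1 => /(_ 1%N isT); rewrite Cb1_abs_ge.
apply/(C0P_one P_top P_closed R)/lambda_ext_C0 => n n0.
by apply: (subclosed_compact _ cY) => //; exact: Cb_abs_ge_closed.
Qed.

Lemma lambda_unique (Z : topologicalType) :
  locally_compact [set: Z] -> hausdorff_space Z ->
  isometrically_isomorphic (C0P P X R) (C0 Z R) -> homeomorphic Z Y.
Proof.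
move=> lcZ hZ [phi iphi].
have [psi [ipsi _ _]] :=
  isometric_isomorphism_inv (C0P_subalgebra P_top P_closed P_sums _ _) lambda_ext_isometric.
apply: (@C0_isomorphic_homeomorphic Y Z R) => //.
- exact: lambda_locally_compact.
- exact: lambda_hausdorff.
- by exists (phi \o psi); exact: isometric_isomorphism_comp iphi.
Qed.

End lambda.

(** * Completeness, and the theorem *)

Section Banach.
Context (X : topologicalType) (R : realType).
Implicit Types f g : Cb X R.

Lemma supnormM f g : `|f * g| <= `|f| * `|g|.
Proof.
apply: supnorm_le => [|x]; first by rewrite mulr_ge0// supnorm_ge0.
by rewrite -[X in `|X|]/(f x * g x) normrM ler_pM// ler_supnorm.
Qed.

(** The limit is taken pointwise.  A function whose ball of radius [e] belongs to the
    filter is within [e] of that limit at every point, so the convergence is uniform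
    and the limit is continuous and bounded. *)
Lemma Cb_complete (F : set_system (Cb X R)) :
  ProperFilter F -> cauchy F -> exists f, F --> f.
Proof.
move=> FF /cauchyP cF.
pose ev (x : X) (f : Cb X R) : R := f x.
have ev_ball f g (e : R) x : ball f e g -> ball (f x) e (g x).
  rewrite -!ball_normE /=; apply: le_lt_trans; exact: (ler_supnorm (f - g) x).
have /choice[u uP] (x : X) : exists l : R, ev x @ F --> l.
  suff cx : cauchy (ev x @ F) by apply/cvg_ex; exact: cauchy_cvg cx.
  apply/cauchyP => e e0; have [f Ff] := cF e e0; exists (f x).
  exact: (filterS (fun g => @ev_ball f g e x) Ff).
have u_near f (e : R) : F (ball f e) -> forall x, `|f x - u x| <= e.
  move=> Ff x; apply: contrapT => /negP; rewrite -ltNge => fxu.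
  pose d := `|f x - u x| - e.
  have d0 : 0 < d by rewrite subr_gt0.
  have Fu : F [set g | ball (u x) d (g x)].
    by have := uP x _ (nbhsx_ballx (u x) d d0).
  have [g [/(@ev_ball _ _ _ x) fg ug]] := filter_ex (filterI Ff Fu).
  move: fg ug; rewrite -!ball_normE /= => fg ug.
  have := ler_distD (g x) (f x) (u x).
  rewrite (distrC (g x)) => h.
  move: ug; rewrite /d; lra.
have cu : continuous u.
  move=> x; apply/cvgrPdist_lt => e e0.
  have e30 : 0 < e / 3 by rewrite divr_gt0.
  have [f Ff] := cF _ e30; have fu := u_near _ _ Ff.
  have := @Cb_continuous _ _ f x => /cvgrPdist_lt/(_ _ e30).
  apply: filterS => y fxy.
  have := fu x; have := fu y; move: fxy.
  rewrite ltr_norml !ler_norml ltr_norml; lra.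
have [f1 Ff1] := cF 1 ltr01.
have uM x : `|u x| <= 1 + supnorm f1.
  have := u_near _ _ Ff1 x; have := ler_supnorm f1 x.
  rewrite !ler_norml; lra.
exists (MkCb (Cb_intro cu uM)).
apply/cvg_ballP => e e0.
have e30 : 0 < e / 3 by rewrite divr_gt0.
have [f Ff] := cF _ e30; have fu := u_near _ _ Ff.
apply: filterS (Ff) => g; rewrite -!ball_normE /= => fg.
apply: (@le_lt_trans _ _ (e / 3 + e / 3)); last by lra.
apply: supnorm_le => [|x]; first by lra.
rewrite -[X in `|X|]/(u x - g x).
have := fu x; have := le_lt_trans (ler_supnorm (f - g) x) fg.
rewrite -[X in `|X| < _]/(f x - g x) !ler_norml ltr_norml; lra.
Qed.

Lemma closed_subalgebra_banach (A : set (Cb X R)) :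
  is_subalgebra A -> closed A -> is_banach_algebra A.
Proof.
move=> Asub cA; split => // [f g _ _|F FF FA cF]; first exact: supnormM.
have [f Ff] := Cb_complete FF cF; exists f => //.
by apply: cA => U /Ff FU; exact: filter_ex (filterI FA FU).
Qed.

End Banach.

Theorem theorem7p9 (R : realType) (X : topologicalType)
    (P : topologicalType -> Prop)
    (P_top : topological_property P)
    (P_closed : closed_hereditary P)
    (P_sums : preserved_finite_closed_sums P) :
  C0P P X R = [set f : Cb X R | forall n, (0 < n)%N -> subset_has P (abs_ge f n)] /\
  (preserved_countable_closed_sums P ->
    C0P P X R = [set f : Cb X R | subset_has P (coz f)]) /\
  (is_ideal (C0P P X R) /\ closed (C0P P X R)) /\
  C00P P X R `<=` C0P P X R /\
  (completely_regular_hausdorff X ->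
    (empty_hull (C0P P X R) <-> locally_has P X)) /\
  (completely_regular_hausdorff X -> locally_has P X ->
    (is_unital (C0P P X R) <-> P X)) /\
  (completely_regular_hausdorff X -> locally_has P X ->
    normal_hausdorff X \/ preserved_countable_closed_sums P ->
    let Y := lambda_space P X R in
    is_banach_algebra (C0P P X R) /\
    (locally_compact [set: Y] /\ hausdorff_space Y) /\
    isometrically_isomorphic (C0P P X R) (C0 Y R) /\
    (forall Z : topologicalType,
      locally_compact [set: Z] -> hausdorff_space Z ->
      isometrically_isomorphic (C0P P X R) (C0 Z R) -> homeomorphic Z Y) /\
    (range (to_stone_cech X R) `<=` lambda_set P X R /\
     dense ([set y | range (to_stone_cech X R) (set_val y)] : set Y)) /\
    C0P P X R `<=` closure (C00P P X R) /\
    (is_unital (C0P P X R) <-> P X) /\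
    (P X <-> compact [set: Y])).
Proof.
split; first exact: C0P_abs_ge.
split; first exact: C0P_coz.
split; first by split; [exact: C0P_ideal|exact: C0P_closed].
split; first exact: C00P_sub_C0P.
split; first by move=> crX; exact: C0P_empty_hull crX.1.
split; first by move=> crX locP; exact: C0P_unital crX.1 locP.
move=> crX locP _ Y.
split.
  by apply: closed_subalgebra_banach; [exact: C0P_subalgebra|exact: C0P_closed].
split; first by split; [exact: lambda_locally_compact|exact: lambda_hausdorff].
split; first by exists (lambda_ext P_top P_closed crX locP); exact: lambda_ext_isometric.
split; first exact: lambda_unique.
split; first split; first exact: iota_lambda.
  move=> O O0 oO.
  have [y [Oy [x _ xy]]] := to_lambda_dense P_top P_closed crX locP O0 oO.
  by exists y; split => //; exists x => //; rewrite -xy.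
split; first exact: C00P_dense.
split; first exact: C0P_unital crX.1 locP.
exact: lambda_compact.
Qed.
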